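(* Let $k\ge 1$. Each stable extension of $\mathsf{FL}^k_{ew}$ has the finite model property. That is, if $\mathsf{L}$ is a stable extension of $\mathsf{FL}^k_{ew}$ and $\varphi$ is a formula with $\mathsf{L}\not\vdash\varphi$, then there is a finite algebra $A\in\mathbb{V}_{\mathsf L}$ such that $A\not\models\varphi$.
   Context: A commutative residuated lattice is an algebra $\langle A,\cdot,\to,\wedge,\vee,1\rangle$ where $\langle A,\cdot,1\rangle$ is a commutative monoid, $\langle A,\wedge,\vee\rangle$ is a lattice (with order $\le$), and $x\cdot y\le z$ iff $y\le x\to z$. It is integral if $x\le 1$ for all $x$, and $k$-potent if $x^{k}=x^{k+1}$ for all $x$. The class (variety) of $k$-potent, commutative, integral residuated lattices is denoted $k\text{-}\mathsf{CIRL}$. Subdirectly irreducible means: nontrivial and having a least congruence among the congruences different from the identity. Formulas are identified with terms in the language $\cdot,\to,\wedge,\vee,1$ over countably many variables. For $B\in k\text{-}\mathsf{CIRL}$, $B\models\varphi$ means $v(\varphi)=1$ for every valuation $v$ into $B$ (homomorphism from the term algebra to $B$). $\mathsf{FL}^k_{ew}$ is the Full Lambek calculus with exchange, weakening and the axiom $\varphi^{k}\leftrightarrow\varphi^{k+1}$; $k\text{-}\mathsf{CIRL}$ is its equivalent algebraic semantics, so $\mathsf{FL}^k_{ew}\vdash\varphi$ iff $B\models\varphi$ for every $B\in k\text{-}\mathsf{CIRL}$. An extension $\mathsf{L}$ of $\mathsf{FL}^k_{ew}$ is an axiomatic extension, i.e. a set of formulas containing all theorems of $\mathsf{FL}^k_{ew}$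 and closed under modus ponens and substitution; it corresponds to the subvariety $\mathbb{V}_{\mathsf L}=\{B\in k\text{-}\mathsf{CIRL}\mid B\models\varphi\text{ for all }\varphi\in\mathsf{L}\}$, and $\mathsf{L}\vdash\varphi$ iff $\mathbb{V}_{\mathsf L}\models\varphi$. A $(\cdot,\vee,1)$-embedding is an injective map preserving $\cdot$, $\vee$ and $1$ (not necessarily $\to$ or $\wedge$). A subvariety $\mathbb{V}$ of $k\text{-}\mathsf{CIRL}$ is stable if, whenever $A,B\in k\text{-}\mathsf{CIRL}$ are subdirectly irreducible, there is a $(\cdot,\vee,1)$-embedding $A\rightarrowtail B$, and $B\in\mathbb{V}$, then $A\in\mathbb{V}$. An extension $\mathsf{L}$ of $\mathsf{FL}^k_{ew}$ is stable if $\mathbb{V}_{\mathsf L}$ is stable. *)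

(* Defs.v *)
From HB Require Import structures.
From mathcomp Require Import all_boot all_order.
From mathcomp Require Import boolp classical_sets functions cardinality.

Set Implicit Arguments.
Unset Strict Implicit.
Unset Printing Implicit Defensive.


HB.mixin Record isCRL d A of Order.Lattice d A & monoid.Monoid A := {
  resid : A -> A -> A;
  mulrlC : forall x y : A, (x * y = y * x)%g;
  residP : forall x y z : A, ((x * y)%g <= z)%O <-> (y <= resid x z)%O
}.

#[short(type="crlType")]
HB.structure Definition CRL d :=
  { A of isCRL d A & Order.Lattice d A & monoid.Monoid A }.

Definition integral d (A : crlType d) : Prop := forall x : A, (x <= 1%g)%O.

Definition kpotent (k : nat) d (A : crlType d) : Prop :=
  forall x : A, (x ^+ k = x ^+ k.+1)%g.

Definition kCIRL (k : nat) d (A : crlType d) : Prop :=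
  integral A /\ kpotent k A.

Definition preserves2 (T : Type) (theta : T -> T -> Prop) (op : T -> T -> T) :=
  forall x x' y y' : T,
    theta x x' -> theta y y' -> theta (op x y) (op x' y').

Record congruence d (A : crlType d) (theta : A -> A -> Prop) : Prop := {
  cong_refl : forall x, theta x x;
  cong_sym : forall x y, theta x y -> theta y x;
  cong_trans : forall x y z, theta x y -> theta y z -> theta x z;
  cong_mul : preserves2 theta (fun x y => (x * y)%g);
  cong_resid : preserves2 theta (@resid d A);
  cong_meet : preserves2 theta (fun x y => (x `&` y)%O);
  cong_join : preserves2 theta (fun x y => (x `|` y)%O)
}.

(* A congruence always contains the identity relation, so differing from it
   amounts to relating two distinct elements. *)
Definition nonidentity (T : Type) (theta : T -> T -> Prop) : Prop :=
  exists x y : T, theta x y /\ x <> y.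

Definition subdirectly_irreducible d (A : crlType d) : Prop :=
  (exists x y : A, x <> y) /\
  exists mu : A -> A -> Prop,
    [/\ congruence mu, nonidentity mu &
        forall theta : A -> A -> Prop,
          congruence theta -> nonidentity theta ->
          forall x y : A, mu x y -> theta x y].

Record mul_join_one_embedding d (A : crlType d) d' (B : crlType d')
    (f : A -> B) : Prop := {
  emb_inj : injective f;
  emb_mul : {morph f : x y / (x * y)%g};
  emb_join : {morph f : x y / (x `|` y)%O};
  emb_one : f 1%g = 1%g
}.

Inductive formula : Type :=
| Var of nat
| One
| Mul of formula & formula
| Imp of formula & formula
| And of formula & formula
| Or of formula & formula.

(* [fpow p 0 = One], [fpow p 1 = p] and [fpow p n.+2 = Mul p (fpow p n.+1)],
   as for [x ^+ n] in a monoid. *)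
Definition fpow (p : formula) (n : nat) : formula := iterop n Mul p One.

Definition Iff (p q : formula) : formula := And (Imp p q) (Imp q p).

Fixpoint fsubst (s : nat -> formula) (p : formula) : formula :=
  match p with
  | Var i => s i
  | One => One
  | Mul q r => Mul (fsubst s q) (fsubst s r)
  | Imp q r => Imp (fsubst s q) (fsubst s r)
  | And q r => And (fsubst s q) (fsubst s r)
  | Or q r => Or (fsubst s q) (fsubst s r)
  end.

(* The homomorphism from the term algebra that extends the assignment [v];
   every homomorphism from the term algebra is of this form. *)
Fixpoint eval d (A : crlType d) (v : nat -> A) (p : formula) : A :=
  match p with
  | Var i => v i
  | One => 1%g
  | Mul q r => (eval v q * eval v r)%g
  | Imp q r => resid (eval v q) (eval v r)
  | And q r => (eval v q `&` eval v r)%O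
  | Or q r => (eval v q `|` eval v r)%O
  end.

Definition models d (A : crlType d) (p : formula) : Prop :=
  forall v : nat -> A, eval v p = 1%g.

(* Sequents with a single succedent. The language has no constant 0, so the
   succedent is never empty and weakening is left weakening only. Exchange
   lets the left rules act on the head of the antecedent. *)
Inductive FLew (k : nat) : seq formula -> formula -> Prop :=
| FL_id p : FLew k [:: p] p
| FL_cut G D p q : FLew k G p -> FLew k (p :: D) q -> FLew k (G ++ D) q
| FL_exchange G D p q r :
    FLew k (G ++ p :: q :: D) r -> FLew k (G ++ q :: p :: D) r
| FL_weakening G p q : FLew k G q -> FLew k (p :: G) q
| FL_oneL G p : FLew k G p -> FLew k (One :: G) p
| FL_oneR : FLew k [::] One
| FL_mulL G p q r : FLew k (p :: q :: G) r -> FLew k (Mul p q :: G) r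
| FL_mulR G D p q : FLew k G p -> FLew k D q -> FLew k (G ++ D) (Mul p q)
| FL_impL G D p q r :
    FLew k G p -> FLew k (q :: D) r -> FLew k (Imp p q :: G ++ D) r
| FL_impR G p q : FLew k (p :: G) q -> FLew k G (Imp p q)
| FL_andL1 G p q r : FLew k (p :: G) r -> FLew k (And p q :: G) r
| FL_andL2 G p q r : FLew k (q :: G) r -> FLew k (And p q :: G) r
| FL_andR G p q : FLew k G p -> FLew k G q -> FLew k G (And p q)
| FL_orL G p q r :
    FLew k (p :: G) r -> FLew k (q :: G) r -> FLew k (Or p q :: G) r
| FL_orR1 G p q : FLew k G p -> FLew k G (Or p q)
| FL_orR2 G p q : FLew k G q -> FLew k G (Or p q)
| FL_potent p : FLew k [::] (Iff (fpow p k) (fpow p k.+1)).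

Definition FLew_theorem (k : nat) (p : formula) : Prop := FLew k [::] p.

(* A logic is identified with its set of theorems. *)
Record extension (k : nat) (L : set formula) : Prop := {
  ext_theorems : forall p, FLew_theorem k p -> L p;
  ext_mp : forall p q, L p -> L (Imp p q) -> L q;
  ext_subst : forall s p, L p -> L (fsubst s p)
}.

Definition variety_of (k : nat) (L : set formula) d (A : crlType d) : Prop :=
  kCIRL k A /\ forall p, L p -> models A p.

Definition stable_class (k : nat)
    (V : forall d, crlType d -> Prop) : Prop :=
  forall d (A : crlType d) d' (B : crlType d'),
    kCIRL k A -> kCIRL k B ->
    subdirectly_irreducible A -> subdirectly_irreducible B ->
    (exists f : A -> B, mul_join_one_embedding f) ->
    V d' B -> V d A.

Definition stable_extension (k : nat) (L : set formula) : Prop :=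
  extension k L /\ stable_class k (@variety_of k L).

Definition finite_model_property (k : nat) (L : set formula) : Prop :=
  forall p : formula, ~ L p ->
    exists d (A : crlType d),
      [/\ finite_set [set: A], variety_of k L A & ~ models A p].

(* Main.v *)
From HB Require Import structures.
Require Import Defs.
From mathcomp Require Import all_boot all_order.
From mathcomp Require Import boolp classical_sets cardinality.

(* If L does not prove p, extend L to a set T of formulas containing the
   theorems, closed under modus ponens and maximal without p. In the
   Lindenbaum algebra A of T, a congruence different from the identity has a
   class of 1 which is strictly larger than T, hence contains p: so A is
   subdirectly irreducible, and by k-potency every x <> 1 satisfies x ^ k <=
   [p], which makes 1 join-prime. By k-potency the (mul, join, 1)-subalgebra
   D of A generated by the values of the subformulas of p is finite; as
   product distributes over joins, D is residuated, with joins of elements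
   of D as residuals and meets. These agree with those of A whenever the
   latter lie in D, so D refutes p. As 1 is join-prime, the elements of D
   other than 1 have a greatest one, so D is subdirectly irreducible, and
   stability puts D in the variety of L. *)

Set Implicit Arguments.
Unset Strict Implicit.
Unset Printing Implicit Defensive.

Import Order.TTheory.
Local Open Scope group_scope.
Local Open Scope order_scope.

HB.instance Definition _ := gen_eqMixin formula.
HB.instance Definition _ := gen_choiceMixin formula.

(** Closure under substitution is left out: a theory maximal among those avoiding a formula need not
    have it. *)
Record theory (k : nat) (T : set formula) : Prop := {
  theory_FLew : forall p, FLew_theorem k p -> T p;
  theory_mp : forall p q, T p -> T (Imp p q) -> T q
}.

(** * The Lindenbaum algebra of a theory *)

Section TheoryOrder.
Variables (k : nat) (T : set formula).
Hypothesis thT : theory k T.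

Lemma FL_swap G p q r : FLew k (p :: q :: G) r -> FLew k (q :: p :: G) r.
Proof. exact: (@FL_exchange k [::]). Qed.

Lemma FL_swap2 G p q r s :
  FLew k (s :: p :: q :: G) r -> FLew k (s :: q :: p :: G) r.
Proof. exact: (@FL_exchange k [:: s]). Qed.

Lemma FL_app G p q r :
  FLew k G p -> FLew k [:: q] r -> FLew k (Imp p q :: G) r.
Proof. by move=> Gp qr; rewrite -(cats0 G); apply: FL_impL. Qed.

Lemma FL_mp p q : FLew k [:: Imp p q; p] q.
Proof. by apply: FL_app; apply: FL_id. Qed.

Lemma theory1 p q : FLew k [:: p] q -> T (Imp p q).
Proof. by move=> pq; apply: (theory_FLew thT); apply: FL_impR. Qed.

Lemma theory2 p q r : FLew k [:: p; q] r -> T p -> T q -> T r.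
Proof.
move=> pqr Tp Tq; apply: (theory_mp thT Tp); apply: (theory_mp thT Tq).
by apply: theory1; apply: FL_impR.
Qed.

Lemma theory_One : T One.
Proof. by apply: (theory_FLew thT); apply: FL_oneR. Qed.

Lemma theory_refl p : T (Imp p p).
Proof. by apply/theory1/FL_id. Qed.

Lemma theory_trans q p r : T (Imp p q) -> T (Imp q r) -> T (Imp p r).
Proof.
apply: theory2; apply/FL_impR/FL_swap2/FL_swap/FL_swap2/FL_app.
  by apply: FL_mp.
by apply: FL_id.
Qed.

Lemma theory_impT p q : T q -> T (Imp p q).
Proof.
move=> Tq; apply: (theory_mp thT Tq).
by apply/theory1/FL_impR/FL_weakening/FL_id.
Qed.

Lemma theory_Imp1 p : T (Imp One p) <-> T p.
Proof.
by split=> [|/theory_impT//]; apply: (theory_mp thT); apply: theory_One.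
Qed.

Lemma theory_Mul p p' q q' :
  T (Imp p p') -> T (Imp q q') -> T (Imp (Mul p q) (Mul p' q')).
Proof.
apply: theory2; apply/FL_impR/FL_mulL/FL_swap2/FL_swap.
apply: (@FL_exchange k [:: Imp p p'; p] [::]).
by apply: (@FL_mulR k [:: _; _]); apply: FL_mp.
Qed.

Lemma theory_MulC p q : T (Imp (Mul p q) (Mul q p)).
Proof.
apply/theory1/FL_mulL/FL_swap.
by apply: (@FL_mulR k [:: _]); apply: FL_id.
Qed.

Lemma theory_MulAl p q r : T (Imp (Mul p (Mul q r)) (Mul (Mul p q) r)).
Proof.
apply/theory1/FL_mulL/FL_swap/FL_mulL/FL_swap2/FL_swap.
apply: (@FL_mulR k [:: _; _]); last exact: FL_id.
by apply: (@FL_mulR k [:: _]); apply: FL_id.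
Qed.

Lemma theory_MulAr p q r : T (Imp (Mul (Mul p q) r) (Mul p (Mul q r))).
Proof.
apply/theory1/FL_mulL/FL_mulL.
apply: (@FL_mulR k [:: _]); first exact: FL_id.
by apply: (@FL_mulR k [:: _]); apply: FL_id.
Qed.

Lemma theory_Mul1l p : T (Imp (Mul One p) p).
Proof. by apply/theory1/FL_mulL/FL_oneL/FL_id. Qed.

Lemma theory_Mul1r p : T (Imp p (Mul One p)).
Proof.
by apply/theory1/(@FL_mulR k [::]); [apply: FL_oneR | apply: FL_id].
Qed.

Lemma theory_residuation p q r :
  T (Imp (Mul p q) r) <-> T (Imp q (Imp p r)).
Proof.
split=> Tr; apply: (theory_mp thT Tr); apply/theory1.
  apply/FL_impR/FL_impR/FL_swap2/FL_swap/FL_app; last exact: FL_id.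
  by apply: (@FL_mulR k [:: _]); apply: FL_id.
apply/FL_impR/FL_mulL/FL_swap2/FL_swap/FL_swap2.
by apply: (@FL_impL k [:: _]); [apply: FL_id | apply: FL_mp].
Qed.

Lemma theory_And p q r :
  T (Imp p (And q r)) <-> T (Imp p q) /\ T (Imp p r).
Proof.
split=> [Tp|[]].
  split; apply: (theory_trans Tp); apply: theory1.
    by apply/FL_andL1/FL_id.
  by apply/FL_andL2/FL_id.
apply: theory2; apply/FL_impR/FL_andR.
  by apply/FL_swap2/FL_swap/FL_weakening/FL_swap/FL_mp.
by apply/FL_swap/FL_weakening/FL_swap/FL_mp.
Qed.

Lemma theory_Or p q r :
  T (Imp (Or p q) r) <-> T (Imp p r) /\ T (Imp q r).
Proof.
split=> [Tr|[]].
  split; apply: theory_trans Tr; apply: theory1.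
    by apply/FL_orR1/FL_id.
  by apply/FL_orR2/FL_id.
apply: theory2; apply/FL_impR/FL_orL.
  by apply/FL_swap2/FL_swap/FL_weakening/FL_swap/FL_mp.
by apply/FL_swap/FL_weakening/FL_swap/FL_mp.
Qed.

Definition interderivable (p q : formula) : bool :=
  `[< T (Imp p q) /\ T (Imp q p) >].

Lemma interderivable_refl : reflexive interderivable.
Proof. by move=> p; apply/asboolP; split; apply: theory_refl. Qed.

Lemma interderivable_sym : symmetric interderivable.
Proof. by move=> p q; apply: asbool_equiv_eq; split=> -[]. Qed.

Lemma interderivable_trans : transitive interderivable.
Proof.
move=> q p r /asboolP[pq qp] /asboolP[qr rq]; apply/asboolP.
by split; apply: (@theory_trans q).
Qed.

Canonical interderivable_equiv :=
  EquivRel interderivable interderivable_refl interderivable_sym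
    interderivable_trans.

End TheoryOrder.

Definition lindenbaum k T (thT : theory k T) : Type :=
  {eq_quot interderivable_equiv thT}%qT.

Section Lindenbaum.
Variables (k : nat) (T : set formula) (thT : theory k T).

Notation LT := (lindenbaum thT).

Notation quot := {eq_quot interderivable_equiv thT}%qT.

HB.instance Definition _ := Choice.copy LT quot.

Definition cls (p : formula) : LT := (\pi_quot p)%qT.
Definition rep (x : LT) : formula := repr (x : quot).

Lemma repK : cancel rep cls.
Proof. exact: reprK. Qed.

Lemma eq_cls p q : cls p = cls q <-> T (Imp p q) /\ T (Imp q p).
Proof.
split=> [/eqP|pq]; last by apply/eqP; rewrite eqmodE; apply/asboolP.
by rewrite eqmodE => /asboolP.
Qed.

Lemma le_rep_cls p : T (Imp (rep (cls p)) p).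
Proof. by have /eq_cls[] := repK (cls p). Qed.

Lemma le_cls_rep p : T (Imp p (rep (cls p))).
Proof. by have /eq_cls[] := repK (cls p). Qed.

Definition lt_le (x y : LT) : bool := `[< T (Imp (rep x) (rep y)) >].

Lemma lt_le_clsl p x : lt_le (cls p) x <-> T (Imp p (rep x)).
Proof.
split=> [/asboolP px|px].
  by apply: (theory_trans thT) px; apply: le_cls_rep.
by apply/asboolP; apply: (theory_trans thT) px; apply: le_rep_cls.
Qed.

Lemma lt_le_clsr p x : lt_le x (cls p) <-> T (Imp (rep x) p).
Proof.
split=> [/asboolP xp|xp].
  by apply: (theory_trans thT xp); apply: le_rep_cls.
by apply/asboolP; apply: (theory_trans thT xp); apply: le_cls_rep.
Qed.

Lemma lt_le_refl : reflexive lt_le.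
Proof. by move=> x; apply/asboolP/(theory_refl thT). Qed.

Lemma lt_le_anti : antisymmetric lt_le.
Proof.
move=> x y /andP[/asboolP xy /asboolP yx].
by rewrite -[x]repK -[y]repK; apply/eq_cls.
Qed.

Lemma lt_le_trans : transitive lt_le.
Proof.
move=> y x z /asboolP xy /asboolP yz; apply/asboolP.
exact: (theory_trans thT xy).
Qed.

HB.instance Definition _ :=
  Order.Le_isPOrder.Build (Order.Disp tt tt) LT
    lt_le_refl lt_le_anti lt_le_trans.

Lemma le_clsP (x y : LT) : x <= y <-> T (Imp (rep x) (rep y)).
Proof. by split=> /asboolP. Qed.

Lemma le_clsE p q : cls p <= cls q <-> T (Imp p q).
Proof.
split=> [/lt_le_clsl pq|pq].
  by apply: (theory_trans thT pq); apply: le_rep_cls.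
by apply/lt_le_clsl; apply: (theory_trans thT pq); apply: le_cls_rep.
Qed.

(** The operations act on chosen representatives; [cls_Mul], [cls_Imp], [cls_And] and [cls_Or] show
    that the choice does not matter. *)
Definition lt_meet (x y : LT) : LT := cls (And (rep x) (rep y)).
Definition lt_join (x y : LT) : LT := cls (Or (rep x) (rep y)).
Definition lt_mul (x y : LT) : LT := cls (Mul (rep x) (rep y)).
Definition lt_resid (x y : LT) : LT := cls (Imp (rep x) (rep y)).

Lemma lt_lexI x y z : (x <= lt_meet y z) = (x <= y) && (x <= z).
Proof.
apply/idP/andP=>
  [/lt_le_clsr/(theory_And thT)[xy xz]|[/le_clsP xy /le_clsP xz]].
  by split; apply/le_clsP.
by apply/lt_le_clsr/(theory_And thT).
Qed.

Lemma lt_leUx x y z : (lt_join x y <= z) = (x <= z) && (y <= z).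
Proof.
apply/idP/andP=>
  [/lt_le_clsl/(theory_Or thT)[xz yz]|[/le_clsP xz /le_clsP yz]].
  by split; apply/le_clsP.
by apply/lt_le_clsl/(theory_Or thT).
Qed.

HB.instance Definition _ :=
  Order.POrder_isMeetSemilattice.Build (Order.Disp tt tt) LT lt_lexI.
HB.instance Definition _ :=
  Order.POrder_isJoinSemilattice.Build (Order.Disp tt tt) LT lt_leUx.

Lemma lt_mulE p q : lt_mul (cls p) (cls q) = cls (Mul p q).
Proof.
by apply/eq_cls; split; apply: (theory_Mul thT);
  (apply: le_rep_cls || apply: le_cls_rep).
Qed.

Lemma lt_mulC : commutative lt_mul.
Proof. by move=> x y; apply/eq_cls; split; apply: (theory_MulC thT). Qed.

Lemma lt_mulA : associative lt_mul.
Proof.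
move=> x y z; rewrite -[x]repK -[y]repK -[z]repK !lt_mulE.
by apply/eq_cls; split; [apply: (theory_MulAl thT) | apply: (theory_MulAr thT)].
Qed.

Lemma lt_mul1x : left_id (cls One) lt_mul.
Proof.
move=> x; rewrite -[x]repK lt_mulE.
by apply/eq_cls; split; [apply: (theory_Mul1l thT) | apply: (theory_Mul1r thT)].
Qed.

Lemma lt_mulx1 : right_id (cls One) lt_mul.
Proof. by move=> x; rewrite lt_mulC lt_mul1x. Qed.

HB.instance Definition _ := isMonoid.Build LT lt_mulA lt_mul1x lt_mulx1.

Lemma lt_residP x y z : lt_mul x y <= z <-> y <= lt_resid x z.
Proof.
split=> [/lt_le_clsl xyz|/lt_le_clsr yxz].
  by apply/lt_le_clsr/(theory_residuation thT).
by apply/lt_le_clsl/(theory_residuation thT).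
Qed.

HB.instance Definition _ := isCRL.Build (Order.Disp tt tt) LT lt_mulC lt_residP.

Lemma cls_Mul p q : cls (Mul p q) = (cls p * cls q)%g.
Proof. by rewrite -lt_mulE. Qed.

Lemma cls_One : cls One = 1%g. Proof. by []. Qed.

(** Both sides obey the residuation law for the same product, hence coincide; [cls_And] and [cls_Or]
    follow likewise from universal properties. *)
Lemma cls_Imp p q : cls (Imp p q) = resid (cls p) (cls q).
Proof.
apply/le_anti/andP; split.
  apply/residP; rewrite -cls_Mul.
  by apply/le_clsE/(theory_residuation thT)/(theory_refl thT).
rewrite -[resid _ _]repK; apply/le_clsE/(theory_residuation thT)/le_clsE.
by rewrite cls_Mul repK; apply/residP.
Qed.

Lemma cls_And p q : cls (And p q) = cls p `&` cls q.
Proof.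
apply/le_anti; rewrite lexI -[_ `&` _]repK -andbA; apply/and3P; split.
- by apply/le_clsE; have /(theory_And thT)[] := theory_refl thT (And p q).
- by apply/le_clsE; have /(theory_And thT)[] := theory_refl thT (And p q).
apply/le_clsE/(theory_And thT).
by split; apply/le_clsE; rewrite repK ?leIl ?leIr.
Qed.

Lemma cls_Or p q : cls (Or p q) = cls p `|` cls q.
Proof.
apply/le_anti; rewrite leUx -[_ `|` _]repK; apply/and3P; split.
- apply/le_clsE/(theory_Or thT).
  by split; apply/le_clsE; rewrite repK ?leUl ?leUr.
- by apply/le_clsE; have /(theory_Or thT)[] := theory_refl thT (Or p q).
by apply/le_clsE; have /(theory_Or thT)[] := theory_refl thT (Or p q).
Qed.

Lemma cls_eq1 p : cls p = 1%g <-> T p.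
Proof.
split=> [/eq_cls[_ /(theory_Imp1 thT)]//|Tp].
by apply/eq_cls; split; apply: (theory_impT thT); [apply: (theory_One thT) | ].
Qed.

Lemma cls_fpow p n : cls (fpow p n) = (cls p ^+ n)%g.
Proof.
(* [iterop] ends at [p], not at [Mul p One], so the induction starts at exponent 1. *)
case: n => // n; rewrite /fpow; elim: n => // n IHn.
by rewrite expgS -IHn -cls_Mul.
Qed.

(** By [repK] every valuation into the Lindenbaum algebra comes from a substitution, so closure of
    [L] under substitution gives validity of [L] there when [T] contains [L]. *)
Lemma eval_cls (s : nat -> formula) p :
  eval (fun i => cls (s i)) p = cls (fsubst s p).
Proof.
elim: p => //= p -> q ->; first by rewrite cls_Mul.
- by rewrite cls_Imp.
- by rewrite cls_And.
by rewrite cls_Or.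
Qed.

Lemma lindenbaum_kCIRL : kCIRL k LT.
Proof.
split=> x; rewrite -[x]repK.
  by rewrite -cls_One; apply/le_clsE/(theory_impT thT)/(theory_One thT).
rewrite -!cls_fpow.
have := theory_FLew thT (FL_potent k (rep x)).
move=> /(theory_Imp1 thT)/(theory_And thT)[].
by move=> /(theory_Imp1 thT) ? /(theory_Imp1 thT) ?; apply/eq_cls.
Qed.

End Lindenbaum.

(** * Integral commutative residuated lattices *)

Section ResiduatedLattice.
Variables (d : Order.disp_t) (A : crlType d).
Implicit Types x y z : A.

(** Multiplication by [x] has a right adjoint, so it preserves joins. *)
Lemma mulgUr x y z : (x * (y `|` z) = x * y `|` x * z)%g.
Proof.
apply/le_anti/andP; split.
  apply/residP; rewrite leUx.
  by apply/andP; split; apply/residP; rewrite ?leUl ?leUr.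
rewrite leUx; apply/andP; split; apply/residP.
  by apply: le_trans (leUl y z) _; apply/residP.
by apply: le_trans (leUr z y) _; apply/residP.
Qed.

Lemma mulgUl x y z : ((y `|` z) * x = y * x `|` z * x)%g.
Proof. by rewrite mulrlC mulgUr ![(x * _)%g]mulrlC. Qed.

Lemma lemul2 x x' y y' : x <= x' -> y <= y' -> (x * y)%g <= (x' * y')%g.
Proof.
move=> /join_idPr <- /join_idPr <-; rewrite mulgUl !mulgUr.
by rewrite (le_trans (leUl _ (x * y')%g)) ?leUl.
Qed.

Lemma resid_le x y : (x * resid x y)%g <= y.
Proof. exact/residP. Qed.

Hypothesis intA : integral A.

Lemma mulg_leI x y : (x * y)%g <= x `&` y.
Proof.
rewrite lexI; apply/andP; split.
  by rewrite -[leRHS]mulg1 lemul2.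
by rewrite -[leRHS]mul1g lemul2.
Qed.

Lemma integral_eq1 x : 1%g <= x -> x = 1%g.
Proof. by move=> x1; apply/le_anti; rewrite x1 intA. Qed.

Lemma resid_eq1 x y : resid x y = 1%g <-> x <= y.
Proof.
split=> [xy|xy]; first by have := resid_le x y; rewrite xy mulg1.
by apply/integral_eq1/residP; rewrite mulg1.
Qed.

(** Expand [(x | y) * (x | z) = 1], with [|] for join: three of the four products lie below [x], the
    last is [y * z]. *)
Lemma joinM_eq1 x y z :
  x `|` y = 1%g -> x `|` z = 1%g -> (x `|` y * z = 1)%g.
Proof.
move=> xy xz; apply: integral_eq1.
have -> : (1 = (x `|` y) * (x `|` z))%g by rewrite xy xz mulg1.
rewrite mulgUl !mulgUr !leUx leUr andbT -!andbA.
have leM := fun a b => le_trans (mulg_leI a b).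
by apply/and3P; split; apply: leM; apply: le_trans (leUl _ _);
  rewrite ?leIl ?leIr.
Qed.

Lemma joinX_eq1 x y n : x `|` y = 1%g -> (x `|` y ^+ n = 1)%g.
Proof.
move=> xy; elim: n => [|n IHn]; first by apply: integral_eq1; rewrite leUr.
by rewrite expgS joinM_eq1.
Qed.

(** If neither [x] nor [y] were 1, both k-th powers would lie below [c]; but their join is 1 by
    [joinX_eq1]. *)
Lemma join_prime k c : c <> 1%g -> (forall x, x <> 1 -> x ^+ k <= c)%g ->
  forall x y, x `|` y = 1%g -> x = 1%g \/ y = 1%g.
Proof.
move=> c1 cmax x y xy; apply: contrapT => /not_orP[x1 y1].
apply/c1/integral_eq1; rewrite -(@joinX_eq1 (x ^+ k)%g y k) ?leUx ?cmax //.
by rewrite joinC joinX_eq1 // joinC.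
Qed.

(** For related [x] and [y], both residuals between them are related to 1, and for distinct [x] and
    [y] antisymmetry prevents both from being 1. *)
Lemma nonidentity_one (theta : A -> A -> Prop) :
  congruence theta -> nonidentity theta -> exists2 x, x <> 1%g & theta x 1%g.
Proof.
move=> ct [x [y [txy neq]]].
have residxx z : resid z z = 1%g by apply/resid_eq1.
have [xy|xy] := pselect (resid x y = 1%g); last first.
  exists (resid x y) => //; rewrite -(residxx y).
  by apply: (cong_resid ct) => //; apply: (cong_refl ct).
exists (resid y x); last first.
  rewrite -(residxx x); apply: (cong_resid ct); last exact: (cong_refl ct).
  exact: (cong_sym ct).
move=> /resid_eq1 yx; apply: neq; apply/le_anti.
by rewrite yx andbT; apply/resid_eq1.
Qed.

Lemma subdirectly_irreducible_of c : c <> 1%g ->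
  (forall theta : A -> A -> Prop,
    congruence theta -> nonidentity theta -> theta c 1%g) ->
  subdirectly_irreducible A.
Proof.
move=> c1 cmin; split; first by exists c, 1%g.
(* The congruence generated by the pair [(c, 1)], as an intersection. *)
exists (fun x y => forall theta : A -> A -> Prop,
  congruence theta -> theta c 1%g -> theta x y).
split; last 2 first.
- by exists c, 1%g.
- by move=> theta ct /(cmin _ ct) tc x y /(_ _ ct tc).
  split=> [x|x y xy|x y z xy yz|x x' y y' xx yy|x x' y y' xx yy
    |x x' y y' xx yy|x x' y y' xx yy] theta ct tc.
  - exact: (cong_refl ct).
  - exact: (cong_sym ct (xy _ ct tc)).
  - exact: (cong_trans ct (xy _ ct tc) (yz _ ct tc)).
  - by apply: (cong_mul ct); [apply: xx | apply: yy].
  - by apply: (cong_resid ct); [apply: xx | apply: yy].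
  - by apply: (cong_meet ct); [apply: xx | apply: yy].
  - by apply: (cong_join ct); [apply: xx | apply: yy].
Qed.

Lemma expg_kpotent k x n : kpotent k A -> (x ^+ (k + n) = x ^+ k)%g.
Proof.
move=> kA; elim: n => [|n IHn]; first by rewrite addn0.
by rewrite addnS expgS IHn -expgS -kA.
Qed.

End ResiduatedLattice.

(** * Finite (mul, join, 1)-subalgebras *)

(** Integrality of [A] is a field so that the residuated lattice on the elements can be built from
    this record alone. *)
Record finite_sub d (A : crlType d) := FiniteSub {
  fsub_elts :> seq A;
  fsub1 : 1%g \in fsub_elts;
  fsubM : {in fsub_elts &, forall x y, (x * y)%g \in fsub_elts};
  fsubU : {in fsub_elts &, forall x y, x `|` y \in fsub_elts};
  fsub_integral : integral A
}.

Section FiniteSub.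
Variables (d : Order.disp_t) (A : crlType d) (s : finite_sub A).

(* The least element of [s], by integrality. *)
Definition fsub_bot : A := foldr *%g 1%g s.

Lemma fsub_bot_in : fsub_bot \in fsub_elts s.
Proof.
rewrite /fsub_bot; have: {subset fsub_elts s <= fsub_elts s} by [].
(* Only the folded list is generalized, to a part of [s]: closure under product holds for [s] as a
   whole. *)
elim: {-2 4}(fsub_elts s) => [|x l IHl] ls /=; first by rewrite fsub1.
apply: fsubM; first by apply: ls; rewrite mem_head.
by apply: IHl => y yl; apply: ls; rewrite inE yl orbT.
Qed.

Lemma fsub_bot_le x : x \in fsub_elts s -> fsub_bot <= x.
Proof.
rewrite /fsub_bot; have leM := mulg_leI (fsub_integral s).
elim: (fsub_elts s) => //= y l IHl; rewrite inE => /predU1P[->|xl].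
  by apply: le_trans (leM _ _) _; rewrite leIl.
by apply: le_trans (leM _ _) _; apply: le_trans (leIr _ _) (IHl xl).
Qed.

(** Starting at [fsub_bot] keeps the join in [s] even if nothing satisfies [P]. It provides meets,
    residuals and the greatest element other than 1. *)
Definition fsub_sup (P : pred A) : A :=
  foldr Order.join fsub_bot [seq x <- fsub_elts s | P x].

Lemma fsub_supP (P : pred A) : P fsub_bot ->
  (forall x y, P x -> P y -> P (x `|` y)) ->
  fsub_sup P \in fsub_elts s /\ P (fsub_sup P).
Proof.
move=> Pb PU; rewrite /fsub_sup.
have: {subset fsub_elts s <= fsub_elts s} by [].
elim: {-2 4}(fsub_elts s) => [|x l IHl] ls /=; first by rewrite fsub_bot_in.
have [|lin Pl] := IHl; first by move=> y yl; apply: ls; rewrite inE yl orbT.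
case: ifP => //= Px; split; last exact: PU.
by apply: fsubU => //; apply: ls; rewrite mem_head.
Qed.

Lemma fsub_sup_ge (P : pred A) x : x \in fsub_elts s -> P x -> x <= fsub_sup P.
Proof.
rewrite /fsub_sup; elim: (fsub_elts s) => //= y l IHl.
rewrite inE => /predU1P[->|xl] Px; first by rewrite Px leUl.
by case: ifP => /= _; rewrite ?(le_trans (IHl xl Px)) ?leUr.
Qed.

Definition fsub_type : Type := seq_sub (fsub_elts s).
Notation D := fsub_type.

HB.instance Definition _ := Finite.copy D (seq_sub (fsub_elts s)).
HB.instance Definition _ := SubChoice.copy D (seq_sub (fsub_elts s)).
HB.instance Definition _ :=
  [SubChoice_isSubPOrder of D by <: with Order.Disp tt tt].

Definition fsub_mk x (xs : x \in fsub_elts s) : D := Sub x xs.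

Lemma fsub_mkK x (xs : x \in fsub_elts s) : val (fsub_mk xs) = x.
Proof. exact: SubK. Qed.

Definition fsub_join (x y : D) : D := fsub_mk (fsubU (valP x) (valP y)).
Definition fsub_mul (x y : D) : D := fsub_mk (fsubM (valP x) (valP y)).
Definition fsub_one : D := fsub_mk (fsub1 s).

Definition below_meet (x y : A) : pred A := fun w => (w <= x) && (w <= y).
Definition below_resid (x z : A) : pred A := fun w => (x * w)%g <= z.

Lemma below_meetP (x y : D) :
  fsub_sup (below_meet (val x) (val y)) \in fsub_elts s /\
  below_meet (val x) (val y) (fsub_sup (below_meet (val x) (val y))).
Proof.
apply: fsub_supP => [|a b]; rewrite /below_meet.
  by rewrite !fsub_bot_le ?(valP x) ?(valP y).
by rewrite !leUx => /andP[-> ->] /andP[-> ->].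
Qed.

(** Solutions of [x * w <= z] are closed under joins by distributivity, and integrality makes the
    least element one of them. *)
Lemma below_residP (x z : D) :
  fsub_sup (below_resid (val x) (val z)) \in fsub_elts s /\
  below_resid (val x) (val z) (fsub_sup (below_resid (val x) (val z))).
Proof.
apply: fsub_supP => [|a b]; rewrite /below_resid.
  apply: le_trans (mulg_leI (fsub_integral s) _ _) _.
  by apply: le_trans (leIr _ _) _; rewrite fsub_bot_le ?(valP z).
by rewrite mulgUr leUx => -> ->.
Qed.

Definition fsub_meet (x y : D) : D := fsub_mk (below_meetP x y).1.
Definition fsub_resid (x y : D) : D := fsub_mk (below_residP x y).1.

Lemma fsub_leE (x y : D) : (x <= y) = (val x <= val y).
Proof. by []. Qed.

Lemma fsub_lexI x y z : (x <= fsub_meet y z) = (x <= y) && (x <= z).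
Proof.
rewrite !fsub_leE fsub_mkK; have /andP[ly lz] := (below_meetP y z).2.
apply/idP/idP => [xyz|]; last exact/fsub_sup_ge/(valP x).
by rewrite !(le_trans xyz).
Qed.

Lemma fsub_leUx x y z : (fsub_join x y <= z) = (x <= z) && (y <= z).
Proof. by rewrite !fsub_leE fsub_mkK leUx. Qed.

HB.instance Definition _ :=
  Order.POrder_isMeetSemilattice.Build (Order.Disp tt tt) D fsub_lexI.
HB.instance Definition _ :=
  Order.POrder_isJoinSemilattice.Build (Order.Disp tt tt) D fsub_leUx.

Lemma fsub_mulA : associative fsub_mul.
Proof. by move=> x y z; apply: val_inj; rewrite !fsub_mkK mulgA. Qed.

Lemma fsub_mulC : commutative fsub_mul.
Proof. by move=> x y; apply: val_inj; rewrite !fsub_mkK mulrlC. Qed.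

Lemma fsub_mul1 : left_id fsub_one fsub_mul.
Proof. by move=> x; apply: val_inj; rewrite !fsub_mkK mul1g. Qed.

Lemma fsub_mulx1 : right_id fsub_one fsub_mul.
Proof. by move=> x; rewrite fsub_mulC fsub_mul1. Qed.

HB.instance Definition _ := isMonoid.Build D fsub_mulA fsub_mul1 fsub_mulx1.

Lemma fsub_residP x y z : fsub_mul x y <= z <-> y <= fsub_resid x z.
Proof.
rewrite !fsub_leE !fsub_mkK; split=> [xyz|/(lemul2 (lexx (val x))) xyz].
  exact/fsub_sup_ge/xyz/(valP y).
exact/(le_trans xyz)/(below_residP x z).2.
Qed.

HB.instance Definition _ :=
  isCRL.Build (Order.Disp tt tt) D fsub_mulC fsub_residP.

Lemma val_fsub_embedding : mul_join_one_embedding (val : D -> A).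
Proof. by split; [apply: val_inj | | |]. Qed.

(** A residual of [A] lying in [s] is among the solutions whose join is the residual of [D]. *)
Lemma val_fsub_resid (x y : D) :
  resid (val x) (val y) \in fsub_elts s ->
  val (resid x y) = resid (val x) (val y).
Proof.
move=> xys; apply/le_anti/andP; split.
  by apply/residP/(below_residP x y).2.
by apply: fsub_sup_ge => //; apply: resid_le.
Qed.

Lemma val_fsub_meet (x y : D) :
  val x `&` val y \in fsub_elts s -> val (x `&` y) = val x `&` val y.
Proof.
move=> xys; apply/le_anti/andP; split.
  by rewrite lexI; apply: (below_meetP x y).2.
by apply: fsub_sup_ge => //; rewrite /below_meet leIl leIr.
Qed.

Lemma fsub_kCIRL k : kCIRL k A -> kCIRL k D.
Proof.
have valX (x : D) n : val (x ^+ n)%g = (val x ^+ n)%g.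
  elim: n => // n IHn; rewrite !expgS -IHn; exact: fsub_mkK.
move=> [intA kA]; split=> x; first by rewrite fsub_leE intA.
by apply: val_inj; rewrite !valX.
Qed.

Lemma fsub_subdirectly_irreducible :
  (forall x y : A, x `|` y = 1%g -> x = 1%g \/ y = 1%g) ->
  (exists x : D, x <> 1%g) -> subdirectly_irreducible D.
Proof.
move=> prime1 [x0 x01].
have intD : integral D by move=> x; rewrite fsub_leE (fsub_integral s).
have bU (x y : A) : x != 1%g -> y != 1%g -> x `|` y != 1%g.
  by move=> /eqP x1 /eqP y1; apply/eqP => /prime1[].
(* If the least element were 1, every element would be 1, against [x0]. *)
have b1 : fsub_bot != 1%g.
  apply/eqP => b1; apply: x01; apply: (integral_eq1 intD).
  by rewrite fsub_leE fsub_mkK -b1 fsub_bot_le // (valP x0).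
have [cs c1] := fsub_supP (P := fun x => x != 1%g) b1 bU.
have val1 x : (x == 1%g :> D) = (val x == 1%g) by [].
apply: (@subdirectly_irreducible_of _ _ (fsub_mk cs)).
  by apply/eqP; rewrite val1 fsub_mkK.
move=> theta ct /(nonidentity_one intD ct)[x /eqP x1 tx].
have xc : x <= fsub_mk cs.
  by rewrite fsub_leE fsub_mkK fsub_sup_ge // (valP x).
(* Joining both sides of [theta x 1] with the greatest element other than 1 relates that element to
   1. *)
have <- : x `|` fsub_mk cs = fsub_mk cs by apply/join_idPr.
have <- : 1%g `|` fsub_mk cs = 1%g by apply/(integral_eq1 intD)/leUl.
by apply: (cong_join ct) => //; apply: (cong_refl ct).
Qed.

Fixpoint subvals (v : nat -> A) (p : formula) : seq A :=
  eval v p ::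
  match p with
  | Var _ | One => [::]
  | Mul q r | Imp q r | And q r | Or q r => subvals v q ++ subvals v r
  end.

(** Residuals and meets agree with those of [A] since the values needed are in [s]. The default 1 of
    [insubd] only affects variables absent from [p]. *)
Lemma val_eval (v : nat -> A) p : {subset subvals v p <= fsub_elts s} ->
  val (eval (fun i => insubd (1%g : D) (v i)) p) = eval v p.
Proof.
have sub2 x l1 l2 : {subset x :: (l1 ++ l2) <= fsub_elts s} ->
  [/\ x \in fsub_elts s, {subset l1 <= fsub_elts s} &
      {subset l2 <= fsub_elts s}].
  move=> ls; split=> [|y yl|y yl]; apply: ls; rewrite inE ?eqxx //.
    by rewrite mem_cat yl orbT.
  by rewrite mem_cat yl !orbT.
elim: p => [i||p IHp q IHq|p IHp q IHq|p IHp q IHq|p IHp q IHq] /=.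
- by move=> ls; rewrite insubdK //; apply: ls; rewrite mem_head.
- by [].
- by move=> /sub2[pqs /IHp <- /IHq <-].
- by move=> /sub2[+ /IHp ep /IHq eq]; rewrite -ep -eq => /val_fsub_resid.
- by move=> /sub2[+ /IHp ep /IHq eq]; rewrite -ep -eq => /val_fsub_meet.
- by move=> /sub2[pqs /IHp <- /IHq <-].
Qed.

End FiniteSub.

(** * Finitely generated (mul, join, 1)-subalgebras and finite refutations *)

Section LocalFiniteness.
Variables (d : Order.disp_t) (A : crlType d) (k : nat).
Hypothesis kA : kCIRL k A.
Implicit Types (x y : A) (s : seq A).

(** Exponents from 0 to [k] suffice by k-potency. *)
Definition monomials s : seq A :=
  foldr (fun x ms => [seq (x ^+ e * m)%g | e <- iota 0 k.+1, m <- ms])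
    [:: 1%g] s.

(** The empty join is excluded, as [A] may lack a least element. *)
Definition joins s : seq A :=
  foldr (fun x js => x :: js ++ [seq x `|` y | y <- js]) [::] s.

Lemma expg_monomial x n : exists2 e, (e <= k)%N & (x ^+ n = x ^+ e)%g.
Proof.
have [nk|/ltnW kn] := leqP n k; first by exists n.
by exists k => //; rewrite -(subnKC kn) expg_kpotent //; case: kA.
Qed.

(** The exponent is arbitrary, reduced to at most [k] by [expg_monomial]; so exponents may be added
    in [monomialsM]. *)
Lemma monomials_cons x s n m :
  m \in monomials s -> (x ^+ n * m)%g \in monomials (x :: s).
Proof.
move=> ms; have [e ek ->] := expg_monomial x n.
by apply/allpairsP; exists (e, m); rewrite mem_iota.
Qed.

Lemma monomials1 s : 1%g \in monomials s.
Proof.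
elim: s => [|x s IHs]; first by rewrite mem_head.
by have := monomials_cons x 0 IHs; rewrite mul1g.
Qed.

Lemma monomials_mem s : {subset s <= monomials s}.
Proof.
elim: s => // x s IHs y; rewrite inE => /predU1P[->|/IHs ys].
  by have := monomials_cons x 1 (monomials1 s); rewrite mulg1.
by have := monomials_cons x 0 ys; rewrite mul1g.
Qed.

Lemma monomialsM s : {in monomials s &, forall x y, (x * y)%g \in monomials s}.
Proof.
elim: s => [|z s IHs] x y.
  by rewrite !inE => /eqP -> /eqP ->; rewrite mulg1.
move=> /allpairsPdep[e [m [_ ms ->]]] /allpairsPdep[e' [m' [_ ms' ->]]].
rewrite mulgA -(mulgA _ m) (mulrlC m) !mulgA -expgnDr -mulgA.
by apply: monomials_cons; apply: IHs.
Qed.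

Lemma joins_mem s : {subset s <= joins s}.
Proof.
elim: s => // x s IHs y; rewrite !inE => /predU1P[->|/IHs ys].
  by rewrite eqxx.
by rewrite mem_cat ys orbT.
Qed.

Lemma joinsU s : {in joins s &, forall x y, x `|` y \in joins s}.
Proof.
elim: s => // z s IHs x y.
have memz w : (w \in joins (z :: s)) <->
    w = z \/ w \in joins s \/ exists2 u, u \in joins s & w = z `|` u.
  rewrite /= inE mem_cat; split=> [/predU1P[->|/orP[]]|[->|[->|[u us ->]]]].
  - by left.
  - by right; left.
  - by move/mapP => [u]; right; right; exists u.
  - by rewrite eqxx.
  - by rewrite orbT.
  - by rewrite map_f ?orbT.
move=> /memz xs /memz ys; apply/memz.
case: xs => [->|[xs|[u us ->]]]; case: ys => [->|[ys|[v vs ->]]].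
- by left; rewrite joinxx.
- by right; right; exists y.
- by right; right; exists v; rewrite // joinA joinxx.
- by right; right; exists x; rewrite // joinC.
- by right; left; apply: IHs.
- by right; right; exists (x `|` v); [apply: IHs | rewrite joinCA].
- by right; right; exists u; rewrite // joinC joinA joinxx.
- by right; right; exists (u `|` y); [apply: IHs | rewrite joinA].
by right; right; exists (u `|` v); [apply: IHs | rewrite joinACA joinxx].
Qed.

Lemma joins_ind s (P : A -> Prop) : (forall x, x \in s -> P x) ->
  (forall x y, P x -> P y -> P (x `|` y)) -> forall x, x \in joins s -> P x.
Proof.
move=> + PU; elim: s => // x s IHs Ps y.
have Px : P x by apply: Ps; rewrite mem_head.
have {}IHs : forall z, z \in joins s -> P z.
  by apply: IHs => z zs; apply: Ps; rewrite inE zs orbT.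
rewrite /= inE mem_cat => /predU1P[->//|/orP[/IHs//|/mapP[z /IHs Pz ->]]].
exact: PU.
Qed.

Lemma joinsM s : {in s &, forall x y, (x * y)%g \in s} ->
  {in joins s &, forall x y, (x * y)%g \in joins s}.
Proof.
move=> sM x y xs ys; move: x xs; apply: joins_ind => [x xs|x x' xy xy'].
  move: y ys; apply: joins_ind => [y ys|y y' xy xy'].
    by apply: joins_mem; apply: sM.
  by rewrite mulgUr joinsU.
by rewrite mulgUl joinsU.
Qed.

(** The joins of monomials do it: distributivity reduces their products to products of monomials. *)
Lemma finite_sub_ex s : exists D : finite_sub A, {subset s <= fsub_elts D}.
Proof.
have MM := joinsM (@monomialsM s).
exists (FiniteSub (joins_mem (monomials1 s)) MM (@joinsU _) kA.1).
by move=> x xs; apply/joins_mem/monomials_mem.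
Qed.

End LocalFiniteness.

Lemma finite_refutation k d (A : crlType d) p : kCIRL k A ->
  (forall x y : A, x `|` y = 1%g -> x = 1%g \/ y = 1%g) -> ~ models A p ->
  exists d' (D : crlType d'), [/\ finite_set [set: D], kCIRL k D,
    subdirectly_irreducible D, ~ models D p &
    exists f : D -> A, mul_join_one_embedding f].
Proof.
move=> kA prime1 /existsNP[v vp].
have [s vs] := finite_sub_ex kA (subvals v p).
pose w i := insubd (1%g : fsub_type s) (v i).
have Dp : eval w p <> 1%g.
  by move/(congr1 val); rewrite val_eval.
exists (Order.Disp tt tt), (fsub_type s); split.
- exact: finite_finset.
- exact: fsub_kCIRL.
(* The refuting value of [p] also witnesses that [D] is nontrivial. *)
- by apply: fsub_subdirectly_irreducible => //; exists (eval w p).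
- by move=> /(_ w)/Dp.
by exists val; apply: val_fsub_embedding.
Qed.

Lemma extension_theory k L : extension k L -> theory k L.
Proof. by case=> thms mp _; split. Qed.

(** * Theories maximal without a given formula *)

Definition maximal_avoiding (k : nat) (p : formula) (T : set formula) : Prop :=
  [/\ theory k T, ~ T p &
      forall T', theory k T' -> (T `<=` T')%classic -> ~ T' p ->
        (T' `<=` T)%classic].

Section ExistsMaximalAvoiding.
Local Open Scope classical_set_scope.

(* Zorn is applied to the X with L `|` X a theory avoiding p, not to the
   theories themselves, because the union of the empty chain is empty. *)
Lemma exists_maximal_avoiding k L p : theory k L -> ~ L p ->
  exists2 T, L `<=` T & maximal_avoiding k p T.
Proof.
move=> thL Lp; pose P X := theory k (L `|` X) /\ ~ (L `|` X) p.
have [|X [[thX Xp] Xmax]] := @Zorn_bigcup formula P.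
  move=> F FP Ftot; split; last first.
    by case=> // -[X FX Xp]; apply: (FP X FX).2; right.
  split=> [q qthm|q r]; first by left; apply: (theory_FLew thL).
  case=> [Lq|[X FX Xq]] [Lqr|[Y FY Yqr]].
  - by left; apply: (theory_mp thL Lq).
  - have LYq : (L `|` Y) q by left.
    have [Lr|Yr] := theory_mp (FP Y FY).1 LYq (or_intror Yqr); first by left.
    by right; exists Y.
  - have LXqr : (L `|` X) (Imp q r) by left.
    have [Lr|Xr] := theory_mp (FP X FX).1 (or_intror Xq) LXqr; first by left.
    by right; exists X.
  (* The chain condition puts both premises into a single member. *)
  have [Z FZ [Zq Zqr]] : exists2 Z, F Z & Z q /\ Z (Imp q r).
    have [XY|YX] := Ftot _ _ FX FY.
      by exists Y => //; split=> //; apply: XY.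
    by exists X => //; split=> //; apply: YX.
  have [Lr|Zr] := theory_mp (FP Z FZ).1 (or_intror Zq) (or_intror Zqr).
    by left.
  by right; exists Z.
exists (L `|` X); first by move=> q; left.
split=> // T' thT' XT' T'p q T'q; apply: contrapT => Xq.
have LT' : L `|` T' = T'.
  by apply/seteqP; split=> [r [Lr|//]|r]; [apply: XT'; left | right].
apply: (Xmax T'); last by split; rewrite LT'.
split=> [r Xr|/(_ q T'q) Xq']; first by apply: XT'; right.
by apply: Xq; right.
Qed.

End ExistsMaximalAvoiding.

(** * Lindenbaum algebras of theories above [L] and of maximal theories *)

Lemma lindenbaum_variety k L T (thT : theory k T) :
  extension k L -> (L `<=` T)%classic -> variety_of k L (lindenbaum thT).
Proof.
move=> extL LT; split; first exact: lindenbaum_kCIRL.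
move=> p Lp v.
have -> : v = fun i => cls thT (rep (v i)) by apply/funext => i; rewrite repK.
rewrite eval_cls; apply/cls_eq1/LT.
exact: (ext_subst extL).
Qed.

Section MaximalAvoiding.
Variables (k : nat) (p : formula) (T : set formula) (thT : theory k T).
Hypothesis Tmax : maximal_avoiding k p T.

Lemma maximal_avoiding_neq1 : cls thT p <> 1%g.
Proof. by case: Tmax => _ Tp _ /cls_eq1. Qed.

(** The formulas with class in the filter [P] form a theory containing [T], strictly larger once [P]
    has an element other than 1; by maximality it contains [p]. *)
Lemma maximal_avoiding_mem (P : lindenbaum thT -> Prop) :
  P 1%g -> (forall x y, P x -> P (resid x y) -> P y) ->
  (exists2 x, x <> 1%g & P x) -> P (cls thT p).
Proof.
case: Tmax => _ _ max P1 Pmp [x x1 Px]; apply: contrapT => Pp.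
apply: x1; rewrite -(repK x); apply/cls_eq1.
apply: (max (fun q => P (cls thT q))) => //; last by rewrite repK.
  split=> [q /(theory_FLew thT)/(@cls_eq1 _ _ thT) ->//|q r Pq].
  by rewrite cls_Imp; apply: Pmp.
by move=> q /(@cls_eq1 _ _ thT) ->.
Qed.

Lemma maximal_avoiding_subdirectly_irreducible :
  subdirectly_irreducible (lindenbaum thT).
Proof.
have [intA _] := lindenbaum_kCIRL thT.
apply: subdirectly_irreducible_of maximal_avoiding_neq1 _ => theta ct nt.
apply: (maximal_avoiding_mem (P := fun x => theta x 1%g)).
- exact: (cong_refl ct).
(* From [x] and [resid x y] related to 1, so is their product, which is below [y]; joining with [y]
   relates [y] to 1. *)
- move=> x y tx txy; have := cong_mul ct tx txy; rewrite mulg1.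
  move=> /(cong_join ct (cong_refl ct y)).
  by rewrite (join_idPl (resid_le x y)) (join_idPr (intA y)).
exact: nonidentity_one.
Qed.

Lemma maximal_avoiding_join_prime (x y : lindenbaum thT) : (1 <= k)%N ->
  x `|` y = 1%g -> x = 1%g \/ y = 1%g.
Proof.
move=> k1; have [intA kA] := lindenbaum_kCIRL thT.
apply: (@join_prime _ _ intA k _ maximal_avoiding_neq1) => z z1.
(* This is the filter generated by [z]: it is closed under modus ponens because
   [z ^+ (k + k) = z ^+ k], and contains [z] because [1 <= k]. *)
apply: (maximal_avoiding_mem (P := fun w => z ^+ k <= w)%g).
- exact: intA.
- move=> u v zu zuv; apply: le_trans (resid_le u v).
  by rewrite -(expg_kpotent z k kA) expgnDr lemul2.
exists z => //; rewrite [X in (z ^+ X)%g](esym (prednK k1)) expgS.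
by apply: le_trans (mulg_leI intA _ _) _; rewrite leIl.
Qed.

End MaximalAvoiding.

Lemma fsubst_Var p : fsubst Var p = p.
Proof. by elim: p => //= p -> q ->. Qed.

Theorem theorem4p7 (k : nat) (L : set formula) :
  (1 <= k)%N -> stable_extension k L -> finite_model_property k L.
Proof.
move=> k1 [extL stabL] p Lp.
have [T LT maxT] := exists_maximal_avoiding (extension_theory extL) Lp.
have [thT Tp _] := maxT.
have VA := lindenbaum_variety thT extL LT.
have nAp : ~ models (lindenbaum thT) p.
  (* Sending each variable to its class evaluates [p] to its own class, which is 1 only if [T]
     contains [p]. *)
  move=> /(_ (fun i => cls thT (Var i))); rewrite eval_cls fsubst_Var.
  by move/cls_eq1.
have prime1 := fun x y => maximal_avoiding_join_prime (x := x) (y := y) maxT k1.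
have [d [D [finD kD siD nDp embD]]] := finite_refutation VA.1 (prime1 thT) nAp.
exists d, D; split=> //.
apply: (stabL _ _ _ (lindenbaum thT)) => //; first exact: VA.1.
exact: maximal_avoiding_subdirectly_irreducible maxT.
Qed.
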